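(* Let $\Gamma$ be a finitely generated torsion-free nilpotent group with finite symmetric generating set $E$, and let $G=\mathrm{Cay}(\Gamma,E)$. If $G$ is not a graphical regular representation of $\Gamma$, then $G$ does not admit an $\mathrm{Aut}(G)$-fiid $\Gamma$-Cayley diagram.
   Context: Assume $e\notin E$. $G=\mathrm{Cay}(\Gamma,E)$ is the graph with vertex set $\Gamma$ and edge set $F=\{(x,\gamma x):x\in\Gamma,\gamma\in E\}$ (edges are ordered pairs). $\Gamma$ embeds into $\mathrm{Aut}(G)$ by $\gamma\mapsto\langle\gamma\rangle$, $\langle\gamma\rangle(x)=x\gamma^{-1}$; $G$ is a graphical regular representation (GRR) of $\Gamma$ if $\mathrm{Aut}(G)=\Gamma$ under this embedding, equivalently if the stabilizer of the vertex $e$ in $\mathrm{Aut}(G)$ is trivial. $\mathrm{Aut}(G)$ acts on $[0,1]^\Gamma$ and on edge labellings by $f\cdot x=x\circ f^{-1}$. A $\Gamma$-Cayley diagram on $G$ is a map $c:F\to E$ such that (i) for every vertex $x$ and $\gamma\in E$ there is exactly one neighbour $y$ of $x$ with $c(x,y)=\gamma$; (ii) for every path $(x_0,\dots,x_n)$ in $G$, $c(x_n,x_{n-1})\cdots c(x_1,x_0)=e$ iff $x_0=x_n$. An $\mathrm{Aut}(G)$-fiid $\Gamma$-Cayley diagram is a measurable map from $([0,1]^\Gamma,\lambda^\Gamma)$ ($\lambda$ Lebesgue measure) to $E^F$ that is $\mathrm{Aut}(G)$-equivariant almost everywhere and almost surely takes values in $\Gamma$-Cayley diagrams. *)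

(* Defs.v *)
From HB Require Import structures.
From mathcomp Require Import all_boot all_order all_algebra.
From mathcomp Require Import all_classical all_reals all_analysis.

Set Implicit Arguments.
Unset Strict Implicit.
Unset Printing Implicit Defensive.

Import Order.TTheory GRing.Theory Num.Theory.

Local Open Scope classical_set_scope.

Definition subgroup (G : groupType) (H : set G) : Prop := group_closed [in H].

Definition generated (G : groupType) (A : set G) : set G :=
  smallest (@subgroup G) A.

Fixpoint lower_central (G : groupType) (n : nat) : set G :=
  if n is m.+1 then
    generated [set [~ x, y]%g | x in @lower_central G m & y in [set: G]]
  else [set: G].
Arguments lower_central G n : clear implicits.

Definition nilpotent_group (G : groupType) : Prop :=
  exists n, lower_central G n = [set 1%g].

Definition torsion_free (G : groupType) : Prop :=
  forall (x : G) (n : nat), (0 < n)%N -> (x ^+ n = 1)%g -> x = 1%g.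

Definition symmetric_set (G : groupType) (A : set G) : Prop :=
  forall x, A x -> A (x^-1)%g.

Record graph_aut (V : Type) (F : set (V * V)) := GraphAut {
  aut_fun :> V -> V;
  aut_inv : V -> V;
  aut_funK : cancel aut_fun aut_inv;
  aut_invK : cancel aut_inv aut_fun;
  aut_edge : forall x y, F (aut_fun x, aut_fun y) <-> F (x, y)
}.

Section Action.
Variables (V : Type) (F : set (V * V)) (f : graph_aut F).

Lemma aut_inv_edge (e : F) :
  (aut_inv f (val e).1, aut_inv f (val e).2) \in F.
Proof.
case: e => [[x y] /= Fxy]; apply/mem_set/(aut_edge f).
by rewrite !aut_invK; exact: set_mem.
Qed.

Definition aut_inv_on_edges (e : F) : F := SigSub (aut_inv_edge e).

Definition act_vertex (T : Type) (w : V -> T) : V -> T := w \o aut_inv f.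

Definition act_edge (T : Type) (c : F -> T) : F -> T := c \o aut_inv_on_edges.

End Action.

Definition Cay (G : groupType) (E : set G) : set (G * G) :=
  [set e | exists2 g, E g & e.2 = (g * e.1)%g].

Definition is_GRR (G : groupType) (E : set G) : Prop :=
  forall f : graph_aut (Cay E), exists g : G, forall x, f x = (x * g^-1)%g.

Section CayleyDiagram.
Variables (G : groupType) (E : set G).
Implicit Types (c : Cay E -> E) (x y : G).

(* The value c(x, y); the default 1 is only used when (x, y) is not an edge. *)
Definition label c x y : G := oapp (fun e => val (c e)) 1%g (insub (x, y)).

(* c(x_n, x_{n-1}) * ... * c(x_1, x_0) for p = [:: x_1; ...; x_n].  Since the
   pairs are read backwards, the standard diagram is c(g * x, x) = g. *)
Fixpoint path_label c (x0 : G) (p : seq G) : G :=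
  if p is x1 :: p' then (path_label c x1 p' * label c x1 x0)%g else 1%g.

Definition cayley_diagram c : Prop :=
  (forall (x : G) (g : E),
     exists! y, (x, y) \in Cay E /\ label c x y = val g) /\
  (forall (x0 : G) (p : seq G),
     path (fun x y => (x, y) \in Cay E) x0 p ->
     (path_label c x0 p = 1%g <-> x0 = last x0 p)).

End CayleyDiagram.

Section UnitInterval.
Variable R : realType.

Definition unit_interval : Type := `[0%R, 1%R]%classic : set R.

Lemma unit_interval0 : (0%R : R) \in (`[0%R, 1%R]%classic : set R).
Proof. by apply/mem_set; rewrite /= in_itv /= lexx ler01. Qed.

Definition ui_val : unit_interval -> R := val.

HB.instance Definition _ := Choice.on unit_interval.
HB.instance Definition _ :=
  isPointed.Build unit_interval (SigSub unit_interval0).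

Definition unitI := g_sigma_algebra_preimageType ui_val.

Definition unitI_lebesgue (A : set unitI) : \bar R :=
  lebesgue_measure (ui_val @` A).

End UnitInterval.

(* The generators of the product sigma-algebra on I -> T, each factor T
   carrying the sigma-algebra M. *)
Definition coordinate_sets (I T : Type) (M : set (set T)) : set (set (I -> T)) :=
  [set (fun w : I -> T => w i) @^-1` B | i in [set: I] & B in M].
Arguments coordinate_sets I {T} M : rename.

Definition unit_cube (R : realType) (I : Type) :=
  g_sigma_algebraType (coordinate_sets I (@measurable _ (unitI R))).

(* This determines P among the measures: finite-dimensional boxes form a
   pi-system that generates the product sigma-algebra. *)
Definition is_lebesgue_power (R : realType) (I : eqType)
    (P : set (unit_cube R I) -> \bar R) : Prop :=
  forall (s : seq I) (A : I -> set (unitI R)),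
    uniq s -> (forall i, measurable (A i)) ->
    P [set w | forall i, i \in s -> A i (w i)]
    = (\prod_(i <- s) unitI_lebesgue (A i))%E.

Section Fiid.
Variables (R : realType) (G : groupType) (E : set G).
Variable P : probability (unit_cube R G) R.

(* E^F carries the product of the discrete sigma-algebras. *)
Definition measurable_labelling (T : unit_cube R G -> (Cay E -> E)) : Prop :=
  forall Y : set (Cay E -> E),
    <<s coordinate_sets (Cay E) [set: set E] >> Y -> measurable (T @^-1` Y).

Definition fiid_cayley_diagram (T : unit_cube R G -> (Cay E -> E)) : Prop :=
  [/\ measurable_labelling T,
      forall f : graph_aut (Cay E),
        {ae P, forall w, T (act_vertex f w) = act_edge f (T w)}
    & {ae P, forall w, cayley_diagram (T w)}].

End Fiid.

(* Main.v *)
Require Import Defs.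
From HB Require Import structures.
From mathcomp Require Import all_boot all_order all_algebra.
From mathcomp Require Import all_classical all_reals all_analysis.
From mathcomp Require Import ring lra.

Set Implicit Arguments.
Unset Strict Implicit.
Unset Printing Implicit Defensive.

Import Order.TTheory GRing.Theory Num.Theory.
Import numFieldNormedType.Exports.

Local Open Scope classical_set_scope.

(** Idea.  A Cayley diagram [c] is the same thing as a bijection [g] of the
group, unique up to right translation, that carries the graph to itself and
reads every label as [g x * (g y)^-1] (diagram_coordinates).  Nilpotency
gives a nontrivial central element [z].  In the diagram [c], moving by [z] is
the map [m = g^-1 o (z * _) o g], which is an automorphism of the graph
because [z] is central.  Call [m x * x^-1] the displacement at [x].

Let now [c] be a random diagram that is an equivariant function of iid
labels.  The action of a sequence of automorphisms that moves every vertex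
out of every finite set is mixing (reindex_mixing), so the displacements at
[1] and at a remote vertex [u] are asymptotically independent.  Hence, if
[a] and [b] both have positive probability as displacement at a vertex, then
for every remote [u] the pairs (displacement at [1], displacement at [u])
equal to [(a, a)] and to [(a, b)] both occur.  Since [m] is an automorphism,
comparing distances before and after the move shows that [a * u * a^-1],
[b * u * a^-1] and [u] have the same length.  With
[u = a^-1 * t ^+ n * a] and [t = b * a^-1] this says that [t ^+ n] and
[t ^+ n.+1] have the same length for all large [n]; all large powers of [t]
then lie in one finite set, and [t = 1] since the group is torsion-free
(displacement_unique).

So the displacement is almost surely one constant [a], that is,
[m x = a * x] for all [x].  As [m] preserves the labels of [c], the
random diagram is almost surely invariant under the fixed automorphism
[a * _] of infinite order; by mixing of its powers every event on a label has
probability 0 or 1 (label_event_zero_one).  The random diagram is therefore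
a constant, and this constant is fixed by all automorphisms of the graph.
The existence of one diagram fixed by every automorphism forces every
automorphism to be a right translation (invariant_diagram_GRR), so the graph
is a graphical regular representation. *)

(** * Mixing from a generating pi-system *)

Section ProbabilityValues.
Local Open Scope ring_scope.
Context d (T : measurableType d) (R : realType) (P : probability T R).
Implicit Types A B : set T.

Lemma fine_probabilityK A : measurable A -> (fine (P A))%:E = P A.
Proof. by move=> mA; rewrite fineK // fin_num_measure. Qed.

Lemma fine_probability_le A B : measurable A -> measurable B ->
  A `<=` B -> fine (P A) <= fine (P B).
Proof.
move=> mA mB AB; rewrite -lee_fin !fine_probabilityK //.
by apply: le_measure => //; rewrite inE.
Qed.

Lemma fine_probabilityD A B : measurable A -> measurable B -> B `<=` A ->
  fine (P (A `\` B)) = fine (P A) - fine (P B).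
Proof.
move=> mA mB BA; apply: EFin_inj; rewrite EFinB !fine_probabilityK //; last first.
  exact: measurableD.
rewrite measureD // ?(setIidr BA) //.
by rewrite ltey_eq fin_num_measure.
Qed.

Lemma cvg_fine_probability (F : nat -> set T) :
  (forall n, measurable (F n)) -> nondecreasing_seq F ->
  fine (P (F n)) @[n --> \oo] --> fine (P (\bigcup_n F n)).
Proof.
move=> mF ndF; apply: fine_cvg; rewrite fine_probabilityK.
  exact: nondecreasing_cvg_mu (bigcupT_measurable _ mF) ndF.
exact: bigcupT_measurable.
Qed.

(** Asymptotic independence of the sets [X n] from [A] needs to be checked only
on a pi-system: the pairs differ by at most the probability of what is
removed from [A], uniformly in [n], so the property passes to increasing
unions. *)
Lemma renyi_mixing (G : set (set T)) (X : nat -> set T) (c : R) :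
  setI_closed G -> G setT -> <<s G >> = @measurable _ T ->
  (forall n, measurable (X n)) ->
  (forall A, G A -> fine (P (A `&` X n)) @[n --> \oo] --> fine (P A) * c) ->
  forall A, measurable A ->
  fine (P (A `&` X n)) @[n --> \oo] --> fine (P A) * c.
Proof.
move=> GI GT sG mX cvgG.
have mG A : G A -> measurable A by move=> GA; rewrite -sG; exact: sub_gen_smallest.
pose H := [set A | measurable A /\
  fine (P (A `&` X n)) @[n --> \oo] --> fine (P A) * c].
suff HG : <<s G >> `<=` H by move=> A; rewrite -sG => /HG[].
apply: lambda_system_subset => //; last by move=> A GA; split; [exact: mG|exact: cvgG].
split => //.
- by split => //; exact: cvgG.
- move=> A B BA [mA cA] [mB cB]; split; first exact: measurableD.
  rewrite fine_probabilityD // mulrBl.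
  rewrite (_ : (fun n => _) =
    (fun n => fine (P (A `&` X n)) - fine (P (B `&` X n)))); first exact: cvgB.
  apply/funext => n; rewrite -fine_probabilityD; [|exact: measurableI..|exact: setSI].
  by congr (fine (P _)); apply/seteqP; split => x /=; tauto.
move=> F ndF HF.
have mF n : measurable (F n) by case: (HF n).
have mU := bigcupT_measurable _ mF.
split => //; set U := \bigcup_n F n in mU *.
apply/cvgrPdist_le => e e0.
have k0 : 0 < `|c| + 1 by rewrite ltr_wpDl.
(* The error e / 2 / (|c| + 1) enters once with weight 1 and once with weight
   |c|. *)
have d0 : 0 < e / 2 / (`|c| + 1) by rewrite !divr_gt0.
have /cvgrPdist_le/(_ _ d0) [N _ /(_ N (leqnn N))] := cvg_fine_probability mF ndF.
rewrite -/U => hN; have FU : F N `<=` U by exact: bigcup_sup.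
have pD : fine (P (U `\` F N)) <= e / 2 / (`|c| + 1).
  by rewrite fine_probabilityD //; apply: le_trans hN; exact: ler_norm.
have Dd : e / 2 / (`|c| + 1) * `|c| + e / 2 / (`|c| + 1) = e / 2.
  by rewrite -[X in _ + X]mulr1 -mulrDr divfK // gt_eqF.
have [_ /cvgrPdist_le/(_ (e / 2))] := HF N.
rewrite divr_gt0 // => /(_ isT) [M _ hM].
exists M => // n /hM /= hn.
have pUX : fine (P (U `&` X n)) - fine (P (F N `&` X n)) <= e / 2 / (`|c| + 1).
  rewrite -fine_probabilityD; [|exact: measurableI..|exact: setSI].
  apply: le_trans pD; apply: fine_probability_le; try exact: measurableD.
    by apply: measurableD; exact: measurableI.
  by move=> x /= [[Ux Xx]] nF; split => // Fx; apply: nF.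
have pUX0 : 0 <= fine (P (U `&` X n)) - fine (P (F N `&` X n)).
  by rewrite subr_ge0; apply: fine_probability_le; [exact: measurableI..|exact: setSI].
have cU : `|(fine (P U) - fine (P (F N))) * c| <= e / 2 / (`|c| + 1) * `|c|.
  by rewrite normrM ler_wpM2r.
rewrite (_ : fine (P U) * c - fine (P (U `&` X n)) =
  (fine (P U) - fine (P (F N))) * c +
  (fine (P (F N)) * c - fine (P (F N `&` X n))) -
  (fine (P (U `&` X n)) - fine (P (F N `&` X n)))); last by ring.
rewrite (le_trans (ler_normB _ _)) //.
rewrite (le_trans (lerD (ler_normD _ _) (lexx _))) //.
by rewrite (ger0_norm pUX0); lra.
Qed.
End ProbabilityValues.

(** * Permuting the coordinates of the cube *)

Section Reindexing.
Local Open Scope ring_scope.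
Variables (R : realType) (I : eqType).
Local Notation cube := (unit_cube R I).
Implicit Types (s : seq I) (A B : I -> set (unitI R)).

Definition box s A : set cube := [set w | forall i, i \in s -> A i (w i)].

Definition boxes : set (set cube) :=
  [set X | exists s A, [/\ uniq s, forall i, measurable (A i) & X = box s A]].

Lemma boxesI : setI_closed boxes.
Proof.
move=> _ _ [s [A [us mA ->]]] [s' [A' [us' mA' ->]]].
pose C (t : seq I) (D : I -> set (unitI R)) i := if i \in t then D i else setT.
exists (undup (s ++ s')), (fun i => C s A i `&` C s' A' i); split.
- exact: undup_uniq.
- by move=> i; apply: measurableI; rewrite /C; case: ifP.
apply/seteqP; split => w /=.
  move=> [hA hA'] i _; rewrite /C; split; case: ifP => // ?; [exact: hA|exact: hA'].
move=> h; split => i si; have := h i; rewrite mem_undup mem_cat si ?orbT /C si.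
  by case/(_ isT).
by case/(_ isT).
Qed.

Lemma boxes_setT : boxes setT.
Proof.
exists [::], (fun=> setT); split => //.
by apply/seteqP; split.
Qed.

Lemma sigma_boxes : <<s boxes >> = @measurable _ cube.
Proof.
apply/seteqP; split.
  apply: smallest_sub; first exact: sigma_algebra_measurable.
  move=> _ [s [A [_ mA ->]]].
  rewrite (_ : box s A =
    \bigcap_(i in [set` s]) ((fun w : cube => w i) @^-1` A i)); last first.
    by apply/seteqP; split.
  apply: fin_bigcap_measurable => // i _.
  by apply: sub_sigma_algebra; exists i => //; exists (A i).
apply: smallest_sub; first exact: smallest_sigma_algebra.
move=> _ [i _ [B mB <-]]; apply: sub_sigma_algebra.
exists [:: i], (fun=> B); split => //.
by apply/seteqP; split => w /= h; [move=> j; rewrite inE => /eqP ->|apply: h; rewrite inE].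
Qed.

Definition reindex (h : I -> I) (w : cube) : cube := w \o h.

Lemma reindex_box h h' s A : cancel h h' ->
  reindex h @^-1` box s A = box (map h s) (A \o h').
Proof.
move=> hK; apply/seteqP; split => w /= hw i.
  by move=> /mapP[j js ->]; rewrite /= hK; exact: hw.
by move=> si; have := hw (h i) (map_f _ si); rewrite /= hK.
Qed.

Lemma measurable_reindex h X : measurable X -> measurable (reindex h @^-1` X).
Proof.
move=> mX.
suff : <<s boxes >> `<=` [set X | measurable (reindex h @^-1` X)].
  by rewrite sigma_boxes; apply.
apply: smallest_sub; first split => /=.
- by rewrite preimage_set0.
- by move=> Y mY; rewrite setTD preimage_setC; exact: measurableC.
- by move=> F mF; rewrite preimage_bigcup; exact: bigcupT_measurable.
move=> _ [s [A [_ mA ->]]] /=.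
rewrite (_ : _ @^-1` _ =
  \bigcap_(i in [set` s]) ((fun w : cube => w (h i)) @^-1` A i)); last first.
  by apply/seteqP; split.
apply: fin_bigcap_measurable => // i _.
by apply: sub_sigma_algebra; exists (h i) => //; exists (A i).
Qed.

Variable P : probability cube R.
Hypothesis Pprod : is_lebesgue_power P.

Lemma probability_box s A : uniq s -> (forall i, measurable (A i)) ->
  P (box s A) = (\prod_(i <- s) unitI_lebesgue (A i))%E.
Proof. exact: Pprod. Qed.

(** Permuting the coordinates permutes the factors of the product that gives
the probability of a box. *)
Lemma probability_reindex h h' X : cancel h h' -> measurable X ->
  P (reindex h @^-1` X) = P X.
Proof.
move=> hK mX.
have mr : measurable_fun setT (reindex h).
  by move=> _ Y mY; rewrite setTI; exact: measurable_reindex.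
have mX' : <<s boxes >> X by rewrite sigma_boxes.
have Hb : [set Y | boxes Y /\ Y `<=` setT] = boxes.
  by apply/seteqP; split => // Y [].
have mboxes : boxes `<=` @measurable _ cube.
  by move=> Y bY; rewrite -sigma_boxes; exact: sub_gen_smallest.
have := @g_sigma_algebra_measure_unique_trace _ R cube boxes setT measurableT.
rewrite Hb => /(_ mboxes boxesI) U.
have [Q QE] : exists Q : {measure set cube -> \bar R}, forall Y, Q Y = P (reindex h @^-1` Y).
  by unshelve eexists; [refine (pushforward P (reindex h)); exact: mr|].
have QT : Q setT = P setT by rewrite QE preimage_setT.
rewrite -QE; apply: (U Q P QT _ _ _ X mX') => //; last by rewrite QT probability_setT ltry.
move=> _ [s [A [us mA ->]]].
rewrite QE (reindex_box _ _ hK) probability_box.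
- rewrite big_map; apply: etrans (esym (probability_box us mA)).
  by apply: eq_bigr => i _; rewrite /= hK.
- by rewrite map_inj_uniq //; exact: can_inj hK.
- by move=> i; exact: mA.
Qed.

Lemma probability_boxesI (s s' : seq I) A A' :
  (forall i, measurable (A i)) -> (forall i, measurable (A' i)) ->
  uniq s -> uniq s' -> (forall i, i \in s -> i \notin s') ->
  P (box s A `&` box s' A') = (P (box s A) * P (box s' A'))%E.
Proof.
move=> mA mA' us us' ss'.
pose B i := if i \in s then A i else A' i.
have -> : box s A `&` box s' A' = box (s ++ s') B.
  apply/seteqP; split => w /=.
    move=> [hA hA'] i; rewrite /B mem_cat; case: ifP => [si _|_ /= s'i]; first exact: hA.
    exact: hA'.
  move=> h; split => i si; have := h i; rewrite mem_cat si ?orbT /B => /(_ isT).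
    by rewrite si.
  by case: ifP => // /ss'; rewrite si.
rewrite probability_box; first last.
- by move=> i; rewrite /B; case: ifP.
- rewrite cat_uniq us us' andbT /=; apply/hasPn => i s'i; apply/negP => /ss'.
  by rewrite s'i.
rewrite big_cat /= !probability_box //; congr (_ * _)%E.
  by rewrite big_seq [RHS]big_seq; apply: eq_bigr => i; rewrite /B => ->.
rewrite big_seq [RHS]big_seq; apply: eq_bigr => i s'i; rewrite /B.
by case: ifP => // /ss'; rewrite s'i.
Qed.

(** Two boxes are exactly independent as soon as the permutation has moved the
finitely many coordinates of the second one off those of the first.  Both
sets are then made general in turn; the invariance of the probability
exchanges their roles. *)
Lemma reindex_mixing (h h' : nat -> I -> I) :
  (forall n, cancel (h n) (h' n)) -> (forall n, cancel (h' n) (h n)) ->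
  (forall i j, \forall n \near \oo, h n i != j) ->
  forall X Y, measurable X -> measurable Y ->
  fine (P (X `&` reindex (h n) @^-1` Y)) @[n --> \oo] --> fine (P X) * fine (P Y).
Proof.
move=> hK h'K esc X Y mX mY.
apply: (renyi_mixing boxesI boxes_setT sigma_boxes) mX => [n|].
  exact: measurable_reindex.
move=> _ [s [A [us mA ->]]].
have mbox : measurable (box s A).
  by rewrite -sigma_boxes; apply: sub_gen_smallest; exists s, A.
have flip n Z : measurable Z ->
    P (Z `&` reindex (h' n) @^-1` box s A) = P (box s A `&` reindex (h n) @^-1` Z).
  move=> mZ; rewrite -(probability_reindex (hK n)); last first.
    by apply: measurableI => //; exact: measurable_reindex.
  have E w : reindex (h' n) (reindex (h n) w) = w.
    by apply/funext => i; rewrite /reindex /= h'K.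
  by congr (P _); apply/seteqP; split => w /=; rewrite /preimage /= E => -[].
(* Seen from the fixed box, it is now [Y] that can be made general. *)
under eq_fun do rewrite -flip //.
rewrite mulrC.
apply: (renyi_mixing boxesI boxes_setT sigma_boxes) mY => [n|].
  exact: measurable_reindex.
move=> _ [s' [A' [us' mA' ->]]].
have mbox' : measurable (box s' A').
  by rewrite -sigma_boxes; apply: sub_gen_smallest; exists s', A'.
under eq_fun do rewrite flip //.
apply: cvg_near_cst.
have : \forall n \near \oo, forall i j, i \in s' -> j \in s -> h n i != j.
  have E2 i : \forall n \near \oo, forall j, j \in s -> h n i != j.
    elim: s {us mbox flip} => [|k s IH]; first by near=> n.
    near=> n => j; rewrite inE => /orP[/eqP ->|].
      by near: n; exact: esc.
    by move: j; near: n.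
  elim: s' {us' mbox'} => [|k s' IH]; first by near=> n.
  near=> n => i j; rewrite inE => /orP[/eqP ->|].
    by move: j; near: n.
  by move: i j; near: n.
apply: filterS => n hn; rewrite (reindex_box _ _ (hK n)) probability_boxesI //.
- rewrite -(reindex_box _ _ (hK n)) (probability_reindex (hK n)) //.
  by rewrite fineM ?fin_num_measure // mulrC.
- by move=> i; exact: mA'.
- by rewrite map_inj_uniq //; exact: can_inj (hK n).
- move=> i si; apply/mapP => -[j s'j ij]; have := hn j i s'j si.
  by rewrite ij eqxx.
Unshelve. all: by end_near. Qed.
End Reindexing.

(** * Almost sure statements *)

Section AlmostSure.
Local Open Scope ring_scope.
Context d (T : measurableType d) (R : realType) (P : probability T R).

Lemma ae_impl (Q Q' : T -> Prop) : (forall w, Q w -> Q' w) ->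
  {ae P, forall w, Q w} -> {ae P, forall w, Q' w}.
Proof. by move=> QQ'; apply: filterS => w; exact: QQ'. Qed.

Lemma ae_and (Q Q' : T -> Prop) : {ae P, forall w, Q w} ->
  {ae P, forall w, Q' w} -> {ae P, forall w, Q w /\ Q' w}.
Proof. by apply: filterS2 => w. Qed.

Lemma ae_exists (Q : T -> Prop) : {ae P, forall w, Q w} -> exists w, Q w.
Proof.
move=> [N [mN N0 QN]]; apply: contrapT => /forallNP nQ.
have : P N = 1%E.
  rewrite (_ : N = setT) ?probability_setT //.
  by apply/seteqP; split => // w _; exact: QN (nQ w).
by rewrite N0 => -[] /eqP; rewrite eq_sym oner_eq0.
Qed.

Lemma eq_probability_ae (A B : set T) : measurable A -> measurable B ->
  {ae P, forall w, A w <-> B w} -> P A = P B.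
Proof.
suff H C D : measurable C -> measurable D -> {ae P, forall w, C w <-> D w} ->
    (P C <= P D)%E.
  move=> mA mB e; apply/eqP; rewrite eq_le !H //.
  by apply: filterS e => w [].
move=> mC mD [N [mN N0 CDN]].
rewrite -(measureU0 mD mN N0); apply: le_measure; rewrite ?inE //.
  exact: measurableU.
move=> w Cw; have [Nw|nNw] := pselect (N w); [by right|left].
by apply: contrapT => nD; apply: nNw; apply: CDN => -[/(_ Cw)].
Qed.

Lemma ae_notin (A : set T) : measurable A -> P A = 0%E <-> {ae P, forall w, ~ A w}.
Proof.
move=> mA; split => [A0|]; first by exists A; split => // w /= /contrapT.
move=> h; rewrite -(measure0 P); apply: eq_probability_ae => //.
by apply: filterS h => w nA; split.
Qed.

Lemma ae_forall_countable (I : Type) (Q : I -> T -> Prop) :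
  countable [set: I] -> (forall i, {ae P, forall w, Q i w}) ->
  {ae P, forall w, forall i, Q i w}.
Proof.
move=> /countable_injP[f f_inj] aeQ.
have H n : {ae P, forall w, forall i, f i = n -> Q i w}.
  have [[i fi]|nf] := pselect (exists i, f i = n).
    apply: filterS (aeQ i) => w Qw j fj.
    by rewrite (_ : j = i) //; apply: f_inj; rewrite ?inE // fi.
  by apply: aeW => w i fi; case: nf; exists i.
by apply: filterS (ae_foralln H) => w Qw i; exact: (Qw (f i)).
Qed.
End AlmostSure.

(** * Words and walks in a Cayley graph *)

Section Groups.
Local Open Scope group_scope.
Variable G : groupType.
Implicit Types (x y z : G) (E H : set G).

Lemma generated_ind E H : E `<=` H -> H 1 ->
  (forall x y, H x -> H y -> H (x * y^-1)) -> generated E `<=` H.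
Proof.
move=> EH H1 HD; apply: smallest_sub => //; split; first exact/mem_set.
by move=> x y /set_mem Hx /set_mem Hy; apply/mem_set; exact: HD.
Qed.

(** The last nontrivial term of the lower central series is central. *)
Lemma nilpotent_center : nilpotent_group G -> [set: G] <> [set 1] ->
  exists2 z, z <> 1 & forall x, commute z x.
Proof.
case; elim=> [|n IH] //= hn nt.
have [h|h] := pselect (lower_central G n = [set 1]); first exact: IH h nt.
have gen_sub E : E `<=` generated E by exact: sub_gen_smallest.
have Ln1 : lower_central G n 1.
  case: n {IH hn h} => [|n] //=.
  by move=> H [[/set_mem H1 _] _].
have [z [Lz z1]] : exists z, lower_central G n z /\ z <> 1.
  apply: contrapT => /forallNP nz; apply: h; apply/seteqP; split => [x Lx|x ->//].
  by apply: contrapT => x1; apply: (nz x).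
exists z => // x; apply/commgP/eqP.
have : generated [set [~ x0, y] | x0 in lower_central G n & y in [set: G]] [~ z, x].
  by apply: gen_sub; exists z => //; exists x.
by rewrite hn.
Qed.

Lemma expg_inj_torsion_free z : torsion_free G -> z <> 1 ->
  injective (fun n => z ^+ n).
Proof.
move=> tf z1; suff H m n : (m < n)%N -> z ^+ m <> z ^+ n.
  by move=> m n mn; case: (ltngtP m n) => // /H; rewrite mn => /(_ erefl).
move=> mn e; apply: z1; apply: (tf _ (n - m)%N); first by rewrite subn_gt0.
by rewrite expgnFr ?(ltnW mn) // e mulgV.
Qed.

(** Products of exactly [n] generators.  Comparing membership in these sets
replaces comparing word lengths; unlike balls they give a recursion without
side cases, and they are still finite and cover the group. *)
Fixpoint words E n : set G :=
  if n is m.+1 then [set x * y | x in E & y in words E m] else [set 1].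

Lemma finite_words E n : finite_set E -> finite_set (words E n).
Proof.
move=> fE; elim: n => [|n IH] /=; first exact: finite_set1.
exact: finite_image2.
Qed.

Lemma words_mul E m n x y : words E m x -> words E n y ->
  words E (m + n) (x * y).
Proof.
elim: m x => [|m IH] x /=; first by move=> ->; rewrite mul1g.
move=> [a Ea [b Wb <-]] Wy; exists a => //; exists (b * y); first exact: IH.
by rewrite mulgA.
Qed.

Lemma wordsV E n x : symmetric_set E -> words E n x ->
  words E n x^-1.
Proof.
move=> sE; elim: n x => [|n IH] x /=; first by move=> ->; rewrite invg1.
move=> [a Ea [b Wb <-]]; rewrite invgM.
suff : words E (n + 1) (b^-1 * a^-1) by rewrite addn1.
have := @words_mul E n 1 _ _ (IH _ Wb); apply.
by exists a^-1; [exact: sE|exists 1; rewrite ?mulg1].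
Qed.

Lemma words_cover E x : symmetric_set E -> generated E = [set: G] ->
  exists n, words E n x.
Proof.
move=> sE gE; have : generated E x by rewrite gE.
apply: (generated_ind (H := [set x | exists n, words E n x])).
- by move=> a Ea; exists 1%N; exists a => //; exists 1; rewrite ?mulg1.
- by exists 0%N.
- move=> a b [m Wa] [n Wb]; exists (m + n)%N.
  by apply: words_mul => //; exact: wordsV.
Qed.

Lemma generated_countable E : finite_set E -> symmetric_set E ->
  generated E = [set: G] -> countable [set: G].
Proof.
move=> fE sE gE.
have -> : [set: G] = \bigcup_n words E n.
  by apply/seteqP; split => // x _; have [n] := words_cover x sE gE; exists n.
apply: bigcup_countable => // n _.
exact/finite_set_countable/finite_words.
Qed.

Lemma Cay_sym E x y : symmetric_set E -> Cay E (x, y) -> Cay E (y, x).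
Proof.
move=> sE [a Ea /= ->]; exists a^-1; first exact: sE.
by rewrite /= mulKg.
Qed.

Lemma CayE E x y : Cay E (x, y) <-> E (y * x^-1).
Proof.
split; first by move=> [a Ea /= ->]; rewrite mulgK.
by move=> Ea; exists (y * x^-1) => //=; rewrite mulgVK.
Qed.

Definition walk E : G -> seq G -> bool := path (fun x y => (x, y) \in Cay E).

Lemma walk_connect E x y : symmetric_set E -> generated E = [set: G] ->
  exists2 p, walk E x p & last x p = y.
Proof.
move=> sE gE; have [n] := words_cover (y * x^-1) sE gE.
elim: n y => [|n IH] y /=.
  by move/divg1_eq => ->; exists [::].
move=> [a Ea [b Wb e]]; have [p wp lp] : exists2 p, walk E x p & last x p = b * x.
  by apply: IH; rewrite mulgK.
exists (rcons p y); last by rewrite last_rcons.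
rewrite /walk rcons_path -/(walk E x p) wp lp /=; apply/mem_set; exists a => //=.
by rewrite mulgA e mulgVK.
Qed.
End Groups.

(** * Cayley diagrams as coordinate systems *)

Section Diagrams.
Local Open Scope group_scope.
Variables (G : groupType) (E : set G).
Hypotheses (E_sym : symmetric_set E) (E_gen : generated E = [set: G]).
Implicit Types (c : Cay E -> E) (x y : G) (p : seq G) (f : graph_aut (Cay E)).

Lemma path_label_cat c x p q :
  path_label c x (p ++ q) = path_label c (last x p) q * path_label c x p.
Proof. by elim: p x => [|y p IH] x /=; rewrite ?mulg1 // IH mulgA. Qed.

Lemma label_edge c x y : Cay E (x, y) -> E (label c x y).
Proof.
move=> /mem_set Fxy; rewrite /label insubT /=; exact: set_mem (valP _).
Qed.

Lemma label_act f c x y : label (act_edge f c) x y = label c (aut_inv f x) (aut_inv f y).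
Proof.
rewrite /label; case: insubP => [e Fe ve|nF]; case: insubP => [e' Fe' ve'|nF'] //=.
- congr (val (c _)); apply: val_inj.
  by rewrite /= ve' ve.
- by have := aut_inv_edge f e; rewrite ve (negPf nF').
- move: nF; rewrite -[x](aut_invK f) -[y](aut_invK f).
  by move/negP; case; apply/mem_set/aut_edge/set_mem.
Qed.

Lemma path_label_act f c x p :
  path_label (act_edge f c) x p = path_label c (aut_inv f x) (map (aut_inv f) p).
Proof. by elim: p x => //= y p IH x; rewrite IH label_act. Qed.

Lemma eq_path_label c c' x p : (forall y z, label c y z = label c' y z) ->
  path_label c x p = path_label c' x p.
Proof. by move=> e; elim: p x => //= y p IH x; rewrite IH e. Qed.

(** The bijection [g] reads a diagram in the group itself: it is the inverse of
the map that sends a product of labels to the end of the walk that carries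
these labels, starting at a base vertex. *)
Record coordinates c (g : G -> G) : Prop := Coordinates {
  coord_edge : forall x y, Cay E (x, y) <-> E (g x * (g y)^-1);
  coord_label : forall x y, Cay E (x, y) -> label c x y = g x * (g y)^-1;
  coord_path : forall x p, walk E x p -> path_label c x p = g (last x p) * (g x)^-1;
  coord_inj : injective g;
  coord_surj : forall y, exists x, g x = y
}.

(** [g x] is the product of the labels along some walk from 1 to [x].  Closed
walks have trivial product, so it does not depend on the walk. *)
Lemma diagram_coordinates c : cayley_diagram c -> exists g, coordinates c g.
Proof.
move=> [c_nbr c_walk].
have from1 x : exists p, walk E 1 p /\ last 1 p = x.
  by have [p] := walk_connect 1 x E_sym E_gen; exists p.
have to1 x : exists p, walk E x p /\ last x p = 1.
  by have [p] := walk_connect x 1 E_sym E_gen; exists p.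
have [q qP] := choice from1; have [r rP] := choice to1.
pose g x := path_label c 1 (q x).
have closed x p : walk E x p -> last x p = x -> path_label c x p = 1.
  by move=> wp lp; apply/(c_walk x p wp); rewrite lp.
have walk_cat x p p' : walk E x (p ++ p') = walk E x p && walk E (last x p) p'.
  exact: cat_path.
have c_path x p : walk E x p -> path_label c x p = g (last x p) * (g x)^-1.
  move=> wp; have [wq lq] := qP x; set y := last x p.
  have [wqy lqy] := qP y; have [wr lr] := rP y.
  have e1 : path_label c 1 (q x ++ p ++ r y) = 1.
    by apply: closed; [rewrite !walk_cat wq lq wp|rewrite !last_cat lq].
  have e2 : path_label c 1 (q y ++ r y) = 1.
    by apply: closed; [rewrite !walk_cat wqy lqy|rewrite !last_cat lqy].
  move: e1 e2; rewrite !path_label_cat lq lqy -/y -/(g x) -/(g y) -mulgA => e1 e2.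
  apply: (mulIg (g x)); rewrite mulgVK.
  by apply: (@mulgI _ (path_label c y (r y))); rewrite e1 e2.
have c_label x y : Cay E (x, y) -> label c x y = g x * (g y)^-1.
  move=> Fxy; have Fyx := Cay_sym E_sym Fxy.
  by have := c_path y [:: x]; rewrite /walk /= mul1g andbT; apply; exact/mem_set.
have g_inj : injective g.
  move=> x y gxy; have [p wp lp] := walk_connect x y E_sym E_gen.
  by rewrite -[y]lp; apply/(c_walk x p wp); rewrite c_path // lp gxy mulgV.
have nbr x a : E a -> exists2 y, Cay E (x, y) & g x * (g y)^-1 = a.
  move=> /mem_set Ea; have [y [[/set_mem Fxy lxy] _]] := c_nbr x (SigSub Ea).
  by exists y => //; rewrite -c_label.
exists g; split => //.
- move=> x y; split; first by move=> Fxy; rewrite -c_label //; exact: label_edge.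
  move=> /(nbr x)[z Fxz] /mulgI/invg_inj/g_inj zy.
  by rewrite -zy.
move=> y.
have [n] := words_cover (y * (g 1)^-1) E_sym E_gen.
elim: n y => [|n IH] y /=; first by move/divg1_eq => ->; exists 1.
move=> [a Ea [b Wb e]]; have [x gx] : exists x, g x = b * g 1.
  by apply: IH; rewrite mulgK.
have [u _ eu] := nbr x _ (E_sym Ea); exists u.
apply: (@mulIg _ (g 1)^-1); rewrite -e -[a]invgK -eu gx !invgM invgK.
by rewrite -!mulgA mulVg mulg1.
Qed.

Section Coordinates.
Variables (c : Cay E -> E) (g : G -> G).
Hypothesis cg : coordinates c g.

(** Coordinates are an automorphism of the graph, hence preserve lengths of
walks. *)
Lemma words_coord n x y : words E n (x * y^-1) <-> words E n (g x * (g y)^-1).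
Proof.
elim: n x => [|n IH] x /=.
  split => [/divg1_eq ->|/divg1_eq/(coord_inj cg) ->]; last by rewrite mulgV.
  by rewrite mulgV.
split => -[a Ea [b Wb e]].
  have eb : a^-1 * x * y^-1 = b by rewrite -mulgA -e mulKg.
  have Fx : Cay E (x, a^-1 * x) by exists a^-1 => //; exact: E_sym.
  exists (g x * (g (a^-1 * x))^-1); first exact/(coord_edge cg).
  exists (g (a^-1 * x) * (g y)^-1); first by apply/IH; rewrite eb.
  by rewrite mulgA mulgVK.
have [u gu] := coord_surj cg (a^-1 * g x).
have eb : g u * (g y)^-1 = b by rewrite gu -mulgA -e mulKg.
have Exu : Cay E (x, u) by apply/(coord_edge cg); rewrite gu invgM invgK mulVKg.
exists (x * u^-1); first exact/CayE/Cay_sym.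
exists (u * y^-1); first by apply/IH; rewrite eb.
by rewrite mulgA mulgVK.
Qed.
End Coordinates.
End Diagrams.

(** * Automorphisms and invariant diagrams *)

Section Automorphisms.
Local Open Scope group_scope.
Variables (G : groupType) (E : set G).

Lemma Cay_translate k x y : Cay E (x * k, y * k) <-> Cay E (x, y).
Proof. by rewrite !CayE invgM mulgA mulgK. Qed.

Definition translation (k : G) : graph_aut (Cay E) :=
  GraphAut (mulgVK k) (mulgK k) (Cay_translate k^-1).

Lemma Cay_left_translateV a :
  (forall x y, Cay E (a * x, a * y) <-> Cay E (x, y)) ->
  forall x y, Cay E (a^-1 * x, a^-1 * y) <-> Cay E (x, y).
Proof. by move=> aF x y; rewrite -aF !mulVKg. Qed.

Definition left_translation (a : G)
    (aF : forall x y, Cay E (a * x, a * y) <-> Cay E (x, y)) : graph_aut (Cay E) :=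
  GraphAut (mulVKg a) (mulKg a) (Cay_left_translateV aF).

Hypotheses (E_sym : symmetric_set E) (E_gen : generated E = [set: G]).

(** Moving by a central element inside a diagram is an automorphism of the
graph: it preserves lengths of walks. *)
Lemma coord_central_shift (c : Cay E -> E) g n x y u v z : coordinates c g ->
  (forall k, commute z k) -> g u = z * g x -> g v = z * g y ->
  words E n (u * v^-1) <-> words E n (x * y^-1).
Proof.
move=> cg zC gu gv.
rewrite (words_coord E_sym cg n u v) (words_coord E_sym cg n x y).
rewrite gu gv invgM -mulgA (zC _).
by rewrite -!mulgA mulVg mulg1.
Qed.

(** Invariance under [f] says that [g] conjugates [f] to a right translation.
Invariance under right translations says that [g] is a homomorphism up to
normalization, so [f] itself is a right translation. *)
Lemma invariant_diagram_GRR (c : Cay E -> E) : cayley_diagram c ->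
  (forall (f : graph_aut (Cay E)) x y,
    label c (aut_inv f x) (aut_inv f y) = label c x y) ->
  is_GRR E.
Proof.
move=> /(diagram_coordinates E_sym E_gen)[g cg] c_inv.
have inv (f : graph_aut (Cay E)) x y : g (aut_inv f x) * (g (aut_inv f y))^-1 = g x * (g y)^-1.
  have [p wp lp] := walk_connect y x E_sym E_gen.
  rewrite -[in RHS]lp -(coord_path cg wp).
  rewrite -(@eq_path_label _ _ (act_edge f c) c) => [|u v]; last by rewrite label_act.
  rewrite path_label_act (coord_path cg) ?last_map ?lp //.
  rewrite /walk path_map; apply: sub_path wp => u v /set_mem Fuv /=.
  by apply/mem_set/(aut_edge f); rewrite !aut_invK.
move=> f; exists (f 1)^-1 => x; rewrite invgK; apply: (coord_inj cg).
apply: (@mulIg _ (g (f 1))^-1).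
rewrite -(inv f) !aut_funK -(inv (translation (f 1)) x 1) /=.
by rewrite mul1g.
Qed.
End Automorphisms.

(** * Events on the labels of a random diagram *)

Section LabelEvents.
Local Open Scope ring_scope.
Variables (R : realType) (G : groupType) (E : set G).
Variable P : probability (unit_cube R G) R.
Hypothesis P_product : is_lebesgue_power P.
Hypothesis G_countable : countable [set: G].
Variable T : unit_cube R G -> (Cay E -> E).
Hypothesis T_measurable : measurable_labelling T.
Hypothesis T_equivariant : forall f : graph_aut (Cay E),
  {ae P, forall w, T (act_vertex f w) = act_edge f (T w)}.
Implicit Types (x y h : G) (p : seq G) (f : graph_aut (Cay E)).

Definition path_event x p h : set (unit_cube R G) :=
  [set w | path_label (T w) x p = h].

Lemma measurable_label x y h : measurable [set w | label (T w) x y = h].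
Proof.
have [Fxy|nF] := boolP ((x, y) \in Cay E).
  rewrite (_ : [set w | _] =
      T @^-1` ((fun c => c (SigSub Fxy)) @^-1` [set a | val a = h])).
    apply: T_measurable; apply: sub_sigma_algebra.
    by exists (SigSub Fxy) => //; exists [set a | val a = h].
  by apply/seteqP; split => w; rewrite /= /label insubT.
(* Outside the edges the label is the default value 1. *)
have [->|h1] := eqVneq h 1%g.
  rewrite (_ : [set w | _] = setT) //.
  by apply/seteqP; split => w //= _; rewrite /label insubF //; exact: negbTE.
rewrite (_ : [set w | _] = set0) //.
apply/seteqP; split => w //=; rewrite /label insubF; last exact: negbTE.
by move=> /= e; move: h1; rewrite -e eqxx.
Qed.

Lemma measurable_countable_bigcup (F : G -> set (unit_cube R G)) :
  (forall i, measurable (F i)) -> measurable (\bigcup_i F i).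
Proof.
move=> mF; have [f f_inj] := countable_injP _ G_countable.
rewrite (_ : \bigcup_i F i = \bigcup_n \bigcup_(i in [set i | f i = n]) F i).
  apply: bigcupT_measurable => n.
  have [[i fi]|nf] := pselect (exists i, f i = n).
    rewrite (_ : [set i | f i = n] = [set i]) ?bigcup_set1 //.
    apply/seteqP; split => j /=; last by move=> ->.
    by rewrite -fi => fj; apply: f_inj; rewrite ?inE.
  rewrite (_ : [set i | f i = n] = set0) ?bigcup_set0 //.
  by apply/seteqP; split => // i fi; case: nf; exists i.
by apply/seteqP; split => w [i _]; [exists (f i) => //; exists i|case=> j _; exists j].
Qed.

(** Conditions on the countably many values of the label of the first step. *)
Lemma measurable_path_event x p h : measurable (path_event x p h).
Proof.
elim: p x h => [|y p IH] x h.
  have [->|h1] := eqVneq h 1%g.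
    rewrite (_ : path_event _ _ _ = setT) //.
    by apply/seteqP; split => w.
  rewrite (_ : path_event _ _ _ = set0) //.
  by apply/seteqP; split => w //= e; move: h1; rewrite -e eqxx.
rewrite (_ : path_event _ _ _ =
  \bigcup_a ([set w | label (T w) y x = a] `&` path_event y p (h * a^-1)%g)).
  apply: measurable_countable_bigcup => a; apply: measurableI => //.
  exact: measurable_label.
apply/seteqP; split => w /=.
  by move=> <-; exists (label (T w) y x) => //; split => //; rewrite /path_event /= mulgK.
by move=> [a _ [/= la]]; rewrite /path_event /= la => ->; rewrite mulgVK.
Qed.

Lemma path_event_act f x p h :
  {ae P, forall w, (reindex (aut_inv f) @^-1` path_event x p h) w <->
    path_event (aut_inv f x) (map (aut_inv f) p) h w}.
Proof.
apply: ae_impl (T_equivariant f) => w; rewrite /act_vertex => e.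
by rewrite /path_event /preimage /= /reindex e path_label_act.
Qed.

Lemma probability_path_event_act f x p h :
  P (path_event (aut_inv f x) (map (aut_inv f) p) h) = P (path_event x p h).
Proof.
have mU := measurable_path_event.
rewrite -[RHS](probability_reindex P_product (aut_invK f)) //.
apply: eq_probability_ae => //; first exact: measurable_reindex.
by apply: ae_impl (path_event_act f x p h) => w [H1 H2]; split.
Qed.

Lemma path_event_mixing (f : nat -> graph_aut (Cay E)) x p h X :
  (forall i j, \forall n \near \oo, aut_inv (f n) i != j) -> measurable X ->
  fine (P (X `&` path_event (aut_inv (f n) x) (map (aut_inv (f n)) p) h))
    @[n --> \oo] --> fine (P X) * fine (P (path_event x p h)).
Proof.
move=> esc mX; have mU := measurable_path_event.
have /(_ _ _ mX (mU x p h)) := reindex_mixing P_product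
  (fun n => aut_invK (f n)) (fun n => aut_funK (f n)) esc.
rewrite (_ : (fun n => _) = (fun n => fine (P (X `&`
  path_event (aut_inv (f n) x) (map (aut_inv (f n)) p) h)))) //.
apply/funext => n; congr fine; apply: eq_probability_ae.
- by apply: measurableI => //; exact: measurable_reindex.
- by apply: measurableI => //; exact: mU.
by apply: ae_impl (path_event_act (f n) x p h) => w [H1 H2]; split => -[] *; split; auto.
Qed.

End LabelEvents.

Lemma injective_escape (G : eqType) (u : nat -> G) x : injective u ->
  \forall n \near \oo, u n != x.
Proof.
move=> u_inj; have [[m um]|nu] := pselect (exists m, u m = x).
  exists m.+1 => // n /= mn; apply/eqP => un.
  by have := u_inj m n; rewrite um un => /(_ erefl) e; rewrite e ltnn in mn.
by near=> n; apply/eqP => e; apply: nu; exists n.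
Unshelve. all: by end_near. Qed.

(** * The displacement of a central element is deterministic *)

Section FiidDiagrams.
Local Open Scope ring_scope.
Variables (R : realType) (G : groupType) (E : set G).
Hypotheses (E_finite : finite_set E) (E_sym : symmetric_set E)
  (E_gen : generated E = [set: G]) (G_tf : torsion_free G).
Variable P : probability (unit_cube R G) R.
Hypothesis P_product : is_lebesgue_power P.
Variable T : unit_cube R G -> (Cay E -> E).
Hypothesis T_fiid : fiid_cayley_diagram P T.
Variable z : G.
Hypotheses (z_nontrivial : z <> 1%g) (z_central : forall x, commute z x).

Let G_countable : countable [set: G] := generated_countable E_finite E_sym E_gen.
Let T_measurable : measurable_labelling T. Proof. by case: T_fiid. Qed.
Let T_equivariant (f : graph_aut (Cay E)) :
  {ae P, forall w, T (act_vertex f w) = act_edge f (T w)}.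
Proof. by case: T_fiid. Qed.
Let T_diagram : {ae P, forall w, cayley_diagram (T w)}.
Proof. by case: T_fiid. Qed.
Let mU := measurable_path_event G_countable T_measurable.

(** The use of mixing: two label events of positive probability occur together,
in an actual diagram, once one of them is moved far enough. *)
Lemma path_event_positive (f : nat -> graph_aut (Cay E)) x p h y q k
    (X := path_event T y q k) :
  (forall i j, \forall n \near \oo, aut_inv (f n) i != j) ->
  P X != 0%E -> P (path_event T x p h) != 0%E ->
  \forall n \near \oo, exists w, [/\ cayley_diagram (T w), X w &
    path_event T (aut_inv (f n) x) (map (aut_inv (f n)) p) h w].
Proof.
move=> esc PX PU.
have gt0 Y : measurable Y -> P Y != 0%E -> 0 < fine (P Y).
  by move=> mY Y0; rewrite fine_gt0 // ltey_eq fin_num_measure // lt0e Y0 measure_ge0.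
have := @path_event_mixing _ _ _ _ P_product G_countable _ T_measurable T_equivariant
  f x p h _ esc (mU y q k).
move=> /cvgrPdist_lt/(_ _ (mulr_gt0 (gt0 _ (mU y q k) PX) (gt0 _ (mU x p h) PU))).
apply: filterS => n; rewrite -/X.
set U := path_event T (aut_inv (f n) x) _ _ => hn.
apply: contrapT => nw.
suff U0 : P (X `&` U) = 0%E by move: hn; rewrite U0 subr0 ltNge ler_norm.
apply/ae_notin; first by apply: measurableI; exact: mU.
by apply: ae_impl T_diagram => w dw [Xw Uw]; apply: nw; exists w.
Qed.

Variable path_to : G -> seq G.
Hypothesis path_toP : forall a, walk E 1%g (path_to a) /\ last 1%g (path_to a) = a.

Definition shift_path (k : G) (p : seq G) : seq G := [seq (x * k)%g | x <- p].

Lemma walk_shift_path k a : walk E k (shift_path k (path_to a)) /\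
  last k (shift_path k (path_to a)) = (a * k)%g.
Proof.
have [wa la] := path_toP a; split; last first.
  by rewrite /shift_path -{1}[k]mul1g (last_map (fun x => x * k)%g) la.
rewrite /walk /shift_path -{1}[k]mul1g (path_map (f := fun x => x * k)%g).
apply: sub_path wa => u v /set_mem Fuv /=.
exact/mem_set/Cay_translate.
Qed.

(** The event that moving from [x] by [z] in the random diagram leads to
[a * x].  It is read on a right translate of one fixed walk from 1 to [a], so
that the events at all [x] are translates of each other. *)
Definition displacement_event a x := path_event T x (shift_path x (path_to a)) z.

Lemma displacement_eventE c g w a x : c = T w -> coordinates c g ->
  displacement_event a x w <-> g (a * x)%g = (z * g x)%g.
Proof.
move=> cE cg; have [wp lp] := walk_shift_path x a.
rewrite /displacement_event /path_event /= -cE (coord_path cg wp) lp.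
split; first by move/eqP; rewrite divg_eq => /eqP.
by move=> ->; rewrite mulgK.
Qed.

Lemma probability_displacement a x :
  P (displacement_event a x) = P (displacement_event a 1%g).
Proof.
rewrite -[RHS](probability_path_event_act P_product G_countable T_measurable
  T_equivariant (translation E x)) /= mul1g -map_comp.
congr (P (path_event _ _ _ _)); apply: eq_map => u /=.
by rewrite mulg1.
Qed.

(** Two displacements [a] and [b] of positive probability both occur at remote
vertices together with the displacement [a] at 1; preservation of lengths
then makes the lengths of the powers of [b * a^-1] eventually constant. *)
Lemma displacement_unique a b : P (displacement_event a 1%g) != 0%E ->
  P (displacement_event b 1%g) != 0%E -> a = b.
Proof.
move=> Pa Pb; apply: contrapT => ab.
pose t := (b * a^-1)%g.
have t1 : t <> 1%g by move=> /divg1_eq ba; apply: ab.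
have t_inj := expg_inj_torsion_free G_tf t1.
(* Chosen so that a * u n * a^-1 = t ^+ n and b * u n * a^-1 = t ^+ n.+1. *)
pose u n := (a^-1 * t ^+ n * a)%g.
have u_inj : injective u by move=> m n /mulIg/mulgI; exact: t_inj.
pose f n := translation E (u n).
have esc i j : \forall n \near \oo, aut_inv (f n) i != j.
  by apply: injective_escape => m n /= /mulgI; exact: u_inj.
have near_words e : P (displacement_event e 1%g) != 0%E ->
    \forall n \near \oo, forall m,
      words E m (e * u n * a^-1)%g <-> words E m (u n).
  move=> Pe; have := @path_event_positive f _ _ _ _ _ _ esc Pa Pe.
  apply: filterS => n [w [dw Xw Uw]] m.
  have [g cg] := diagram_coordinates E_sym E_gen dw.
  have ga : g (a * 1)%g = (z * g 1)%g by apply/(displacement_eventE a 1%g _ cg).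
  have ge : g (e * u n)%g = (z * g (u n))%g.
    apply/(displacement_eventE e (u n) _ cg) => //.
    move: Uw; rewrite /displacement_event /path_event /= mul1g -map_comp => <-.
    by congr (path_label _ _ _); apply: eq_map => v /=; rewrite mulg1.
  have := coord_central_shift E_sym m cg z_central ge ga.
  by rewrite mulg1 invg1 mulg1.
have step : \forall n \near \oo, forall m, words E m (t ^+ n)%g -> words E m (t ^+ n.+1)%g.
  near=> n => m Wt.
  have wa : forall m, words E m (a * u n * a^-1)%g <-> words E m (u n).
    by near: n; exact: near_words.
  have wb : forall m, words E m (b * u n * a^-1)%g <-> words E m (u n).
    by near: n; exact: near_words.
  suff : words E m (b * u n * a^-1)%g by rewrite /u !mulgA mulgK -/t expgS.
  by apply/wb/wa; rewrite /u !mulgA mulgK mulgV mul1g.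
have [N _ stepN] := step.
have [m Wm] := words_cover (t ^+ N)%g E_sym E_gen.
have Wk k : words E m (t ^+ (N + k))%g.
  elim: k => [|k IH]; first by rewrite addn0.
  by rewrite addnS; apply: stepN => //=; exact: leq_addr.
apply: infinite_nat.
have v_inj : injective (fun k => t ^+ (N + k))%g by move=> i j /t_inj/addnI.
rewrite (_ : [set: nat] = (fun k => t ^+ (N + k))%g @^-1` words E m).
  apply: finite_preimage; first by move=> i j _ _; exact: v_inj.
  exact: finite_words.
by apply/seteqP; split => // k _; exact: Wk.
Unshelve. all: by end_near. Qed.

(** Among the countably many displacements at 1 one has positive probability;
all others are null at 1, hence at every vertex by invariance. *)
Lemma displacement_deterministic : exists2 a, a <> 1%g &
  {ae P, forall w, exists2 g, coordinates (T w) g & forall x, g (a * x)%g = (z * g x)%g}.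
Proof.
have dis w x g : coordinates (T w) g -> exists a, displacement_event a x w.
  move=> cg; have [y gy] := coord_surj cg (z * g x)%g.
  by exists (y * x^-1)%g; apply/(displacement_eventE _ _ erefl cg); rewrite mulgVK.
have [a Pa] : exists a, P (displacement_event a 1%g) != 0%E.
  apply: contrapT => /forallNP na.
  have : {ae P, forall w, forall a, ~ displacement_event a 1%g w}.
    apply: ae_forall_countable => // a; apply/ae_notin; first exact: mU.
    by have /negP := na a; rewrite negbK => /eqP.
  move=> /ae_and/(_ T_diagram)/ae_exists[w [nw]].
  move=> /(diagram_coordinates E_sym E_gen)[g cg].
  by have [a] := dis w 1%g g cg; exact: nw.
have ae_a : {ae P, forall w, forall x b, b <> a -> ~ displacement_event b x w}.
  apply: ae_forall_countable => // x; apply: ae_forall_countable => // b.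
  have [->|ba] := eqVneq b a; first by apply: aeW => w.
  suff : {ae P, forall w, ~ displacement_event b x w} by apply: ae_impl.
  apply/ae_notin; first exact: mU.
  rewrite probability_displacement; apply/eqP; apply: contraT => Pb.
  by rewrite (displacement_unique Pb Pa) eqxx in ba.
have ae_g : {ae P, forall w, exists2 g, coordinates (T w) g &
                               forall x, g (a * x)%g = (z * g x)%g}.
  apply: ae_impl (ae_and ae_a T_diagram) => w [nw].
  move=> /(diagram_coordinates E_sym E_gen)[g cg]; exists g => // x.
  apply/(displacement_eventE _ _ erefl cg).
  have [b bx] := dis w x g cg.
  by have [<- //|/eqP ba] := eqVneq b a; case: (nw x b ba).
exists a => // a1.
have [w [g cg /(_ 1%g)]] := ae_exists ae_g.
by rewrite a1 mulg1 -{1}[g 1%g]mul1g => /mulIg z1; exact: z_nontrivial.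
Qed.
End FiidDiagrams.

(** * A diagram with constant displacement is deterministic *)

Section DeterministicDiagram.
Local Open Scope ring_scope.
Variables (R : realType) (G : groupType) (E : set G).
Hypotheses (E_sym : symmetric_set E) (E_gen : generated E = [set: G])
  (G_countable : countable [set: G]) (G_tf : torsion_free G).
Variable P : probability (unit_cube R G) R.
Hypothesis P_product : is_lebesgue_power P.
Variable T : unit_cube R G -> (Cay E -> E).
Hypothesis T_fiid : fiid_cayley_diagram P T.
Variables (z a : G).
Hypotheses (z_central : forall x, commute z x) (a_nontrivial : a <> 1%g)
  (shift_a : {ae P, forall w, exists2 g, coordinates (T w) g &
                                forall x, g (a * x)%g = (z * g x)%g}).

Let T_measurable : measurable_labelling T. Proof. by case: T_fiid. Qed.
Let T_equivariant (f : graph_aut (Cay E)) :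
  {ae P, forall w, T (act_vertex f w) = act_edge f (T w)}.
Proof. by case: T_fiid. Qed.
Let T_diagram : {ae P, forall w, cayley_diagram (T w)}.
Proof. by case: T_fiid. Qed.
Let mU := measurable_path_event G_countable T_measurable.

Definition label_event x y h := path_event T y [:: x] h.

Lemma label_eventE x y h w : label_event x y h w <-> label (T w) x y = h.
Proof. by rewrite /label_event /path_event /= mul1g. Qed.

Lemma coord_shift (c : Cay E -> E) g n x y : coordinates c g ->
  (forall x, g (a * x) = z * g x)%g ->
  (g (a ^+ n * x) * (g (a ^+ n * y))^-1 = g x * (g y)^-1)%g.
Proof.
move=> cg ga; elim: n => [|n IH]; first by rewrite expg0 !mul1g.
rewrite -IH expgS -!mulgA !ga invgM -mulgA z_central.
by rewrite -!mulgA mulVg mulg1.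
Qed.

Lemma Cay_shift n x y : Cay E (a ^+ n * x, a ^+ n * y)%g <-> Cay E (x, y).
Proof.
have [w [g cg ga]] := ae_exists shift_a.
by rewrite !(coord_edge cg) (coord_shift n x y cg ga).
Qed.

(** The left translation by [a] is the move by [z] in the diagram, and this move
preserves the labels since [z] is central. *)
Lemma label_shift n x y :
  {ae P, forall w, label (T w) (a ^+ n * x)%g (a ^+ n * y)%g = label (T w) x y}.
Proof.
apply: ae_impl shift_a => w [g cg ga].
have [Fxy|nF] := pselect (Cay E (x, y)).
  by rewrite !(coord_label cg) ?(coord_shift n x y cg ga) //; exact/Cay_shift.
rewrite /label !insubF //; apply/negP => /set_mem //.
by move/Cay_shift.
Qed.

(** An almost surely invariant event is independent of itself, by mixing. *)
Lemma label_event_zero_one x y h :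
  P (label_event x y h) = 0%E \/ P (label_event x y h) = 1%E.
Proof.
have mL : measurable (label_event x y h) by exact: mU.
pose f n := left_translation (fun u v => Cay_shift n u v).
have f_esc (i j : G) : \forall n \near \oo, aut_inv (f n) i != j.
  apply: injective_escape => m n /mulIg; exact: expg_inj_torsion_free.
have := path_event_mixing P_product G_countable T_measurable T_equivariant
  f_esc mL.
move=> /(_ y [:: x] h).
rewrite (_ : (fun n => _) = fun=> fine (P (label_event x y h))); last first.
  apply/funext => n; congr fine; apply: eq_probability_ae => //.
    by apply: measurableI => //; exact: mU.
  apply: ae_impl (label_shift n x y) => w /= e; split; first by case.
  move=> Lw; split => //; apply/label_eventE.
  by rewrite e; exact/label_eventE.
move=> /cvg_lim; rewrite lim_cst // => /(_ (@Rhausdorff R)) e.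
have : fine (P (label_event x y h)) * (fine (P (label_event x y h)) - 1) = 0.
  by rewrite mulrBr mulr1 -e subrr.
move/eqP; rewrite mulf_eq0 subr_eq0.
by case/orP => /eqP p01; [left|right]; rewrite -(fine_probabilityK P mL) p01.
Qed.

Lemma ae_label_event x y h : P (label_event x y h) <> 0%E ->
  {ae P, forall w, label (T w) x y = h}.
Proof.
have mL : measurable (label_event x y h) by exact: mU.
case: (label_event_zero_one x y h) => [-> //|L1 _].
suff : {ae P, forall w, ~ (~` label_event x y h) w}.
  by apply: ae_impl => w /contrapT/label_eventE.
apply/ae_notin; first exact: measurableC.
by rewrite probability_setC // L1 subee.
Qed.

Lemma deterministic_label x y :
  exists h, P (label_event x y h) <> 0%E.
Proof.
apply: contrapT => /forallNP nh.
have : {ae P, forall w, forall h, ~ label_event x y h w}.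
  apply: ae_forall_countable => // h; apply/ae_notin; first exact: mU.
  exact: contrapT (nh h).
move=> /ae_exists[w /(_ (label (T w) x y))]; apply.
exact/label_eventE.
Qed.

(** The law of the random diagram is invariant under all automorphisms of the
graph; being concentrated on one diagram, it makes this diagram invariant. *)
Lemma deterministic_diagram_GRR : is_GRR E.
Proof.
have [k kP] := choice (fun xy : G * G => deterministic_label xy.1 xy.2).
have ae_k : {ae P, forall w, forall x y, label (T w) x y = k (x, y)}.
  apply: ae_forall_countable => // x; apply: ae_forall_countable => // y.
  exact: ae_label_event (kP (x, y)).
have [w [wk dw]] := ae_exists (ae_and ae_k T_diagram).
apply: (invariant_diagram_GRR E_sym E_gen dw) => f x y.
rewrite !wk; have := kP (x, y); rewrite /label_event /=.
rewrite -(probability_path_event_act P_product G_countable T_measurable T_equivariant f).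
move=> /(@ae_label_event _ _ _)/(ae_and ae_k)/ae_exists[w' [wk' <-]].
by rewrite wk'.
Qed.
End DeterministicDiagram.

Theorem theorem1p5 (R : realType) (Gamma : groupType) (E : set Gamma)
    (P : probability (unit_cube R Gamma) R)
    (E_finite : finite_set E)
    (E_symmetric : symmetric_set E)
    (E_no_unit : ~ E 1%g)
    (E_generates : generated E = [set: Gamma])
    (Gamma_torsion_free : torsion_free Gamma)
    (Gamma_nilpotent : nilpotent_group Gamma)
    (P_product : is_lebesgue_power P) :
  ~ is_GRR E ->
  ~ exists T : unit_cube R Gamma -> (Cay E -> E), fiid_cayley_diagram P T.
Proof.
move=> nGRR [T T_fiid]; apply: nGRR.
have [triv|nt] := pselect ([set: Gamma] = [set 1%g]).
  have all1 (x : Gamma) : x = 1%g by have : [set: Gamma] x by []; rewrite triv.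
  by move=> f; exists 1%g => x; rewrite (all1 (f x)) (all1 (_ * _)%g).
have [z z1 zC] := nilpotent_center Gamma_nilpotent nt.
have path1 x : exists p, walk E 1%g p /\ last 1%g p = x.
  by have [p] := walk_connect 1%g x E_symmetric E_generates; exists p.
have [q qP] := choice path1.
have [a a1 shift_a] := displacement_deterministic E_finite E_symmetric E_generates
  Gamma_torsion_free P_product T_fiid z1 zC qP.
exact: (deterministic_diagram_GRR E_symmetric E_generates
  (generated_countable E_finite E_symmetric E_generates) Gamma_torsion_free
  P_product T_fiid zC a1 shift_a).
Qed.
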